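(* Let $-\infty\le a<b\le\infty$, let $\phi:(a,b)\to\mathbb{R}$ be strictly convex and continuously differentiable, and for $x,\theta\in(a,b)$ let $d_\phi(x,\theta)=\phi(x)-\phi(\theta)-\phi'(\theta)(x-\theta)$. Assume there is $\zeta\in(0,\infty]$ such that for every $\theta\in(a,b)$, $$\lim_{x\to a^+}d_\phi(x,\theta)=\lim_{x\to b^-}d_\phi(x,\theta)=\zeta.$$ Let $g:[0,\infty)\to[0,\infty)$ be measurable and consider the continuous Bregman distribution $$p(x\mid\theta)=\frac{1}{C(\theta)}\,\frac{\phi'(x)-\phi'(\theta)}{x-\theta}\,g\big(d_\phi(x,\theta)\big),\qquad x\in(a,b),$$ where $\theta\in(a,b)$ and $0<C(\theta)<\infty$ is the normalizing constant (the ratio is interpreted as a nonnegative function of $x$; its value at $x=\theta$ is irrelevant). Let $f:[0,\infty)\to\mathbb{R}$ be differentiable. If $$\int_0^\infty g(t)\,|f'(t)|\,dt<\infty,$$ then $$\int_a^b p(x\mid\theta)\, f'\big(d_\phi(x,\theta)\big)\,(x-\theta)\,dx=0,$$ i.e. the estimating equation (with the same Bregman divergence $d_\phi$ used for estimation as in the model) holds without any bias-correction term.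
   Context: The parameter is estimated by minimizing $\int p(x)\,f(d_\phi(x,\theta))\,dx$; for a Bregman divergence $d_\phi$ the stationarity condition is the displayed estimating equation, and ''unbiased'' means it holds at the true parameter of the model. *)

(* Defs.v *)
From HB Require Import structures.
From mathcomp Require Import all_boot all_order all_algebra.
From mathcomp Require Import all_classical all_reals all_analysis.
Set Implicit Arguments. Unset Strict Implicit. Unset Printing Implicit Defensive.
Import Order.TTheory GRing.Theory Num.Theory.
Import numFieldNormedType.Exports.
Local Open Scope classical_set_scope.
Local Open Scope ring_scope.

Definition open_itv (R : realType) (a b : \bar R) : set R :=
  [set x : R | (a < x%:E)%E /\ (x%:E < b)%E].

Definition left_end_filter (R : realType) (a : \bar R) : set_system R :=
  match a with
  | EFin r => at_right r
  | _ => ninfty_nbhs R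
  end.

Definition right_end_filter (R : realType) (b : \bar R) : set_system R :=
  match b with
  | EFin r => at_left r
  | _ => pinfty_nbhs R
  end.

Definition strictly_convex_on (R : realType) (I : set R) (phi : R -> R) : Prop :=
  forall x y t : R, I x -> I y -> x != y -> 0 < t < 1 ->
    phi (t * x + (1 - t) * y) < t * phi x + (1 - t) * phi y.

Definition bregman (R : realType) (phi : R -> R) (x theta : R) : R :=
  phi x - phi theta - (derive1 phi) theta * (x - theta).

Definition bregman_ratio (R : realType) (phi : R -> R) (x theta : R) : R :=
  ((derive1 phi) x - (derive1 phi) theta) / (x - theta).

Definition bregman_density (R : realType) (phi g : R -> R) (C : R)
    (x theta : R) : R :=
  C^-1 * bregman_ratio phi x theta * g (bregman phi x theta).

(* Main.v *)
(** With D x = d_phi(x, theta), strict convexity makes D strictly decreasing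
    from zeta to 0 on (a, theta) and strictly increasing from 0 to zeta on
    (theta, b), and D' = phi' - phi'(theta).  Since the factor x - theta cancels
    the denominator of the density, the integrand is D' * (g f')(D) / C, so that
    the substitution t = D x turns the integrals over the two halves into
    -1/C and +1/C times the integral of g f' over (0, zeta).

    As g f' is only measurable, the substitution is obtained by comparing the
    image under D of the measure |D'| dx with Lebesgue measure on (0, zeta):
    both give mass c to ]-oo, c[ for 0 < c < zeta, and such rays determine
    the measure. *)

Require Import Defs.
From HB Require Import structures.
From mathcomp Require Import all_boot all_order all_algebra.
From mathcomp Require Import all_classical all_reals all_analysis.
From mathcomp Require Import measurable_realfun ring lra.
Import Order.TTheory GRing.Theory Num.Theory.
Import numFieldNormedType.Exports.
Local Open Scope classical_set_scope.
Local Open Scope ring_scope.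

(** * Change of variables for measurable integrands *)

Section weighted_pushforward.
Local Open Scope ereal_scope.
Context d d' (T : measurableType d) (T' : measurableType d') (R : realType).
Variables (mu : {measure set T -> \bar R}) (D : set T) (F : T -> T').
Variable (w : T -> R).
Hypotheses (mD : measurable D) (mF : measurable_fun D F).
Hypotheses (mw : measurable_fun D w) (w0 : forall x, D x -> (0 <= w x)%R).

(** Preimages of disjoint sets are disjoint, so countable additivity is that of the integral of the
    nonnegative [w] over a disjoint union. The formula is the definition of [nu], hence available
    for every [A], measurable or not. *)
Lemma weighted_pushforward_exists : exists nu : {measure set T' -> \bar R},
  forall A, nu A = \int[mu]_(x in D `&` F @^-1` A) (w x)%:E.
Proof.
pose nu A := \int[mu]_(x in D `&` F @^-1` A) (w x)%:E.
have nu0 : nu set0 = 0 by rewrite /nu preimage_set0 setI0 integral_set0.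
have nu_ge0 A : 0 <= nu A.
  by apply: integral_ge0 => x [Dx _]; rewrite lee_fin w0.
have nu_sa : semi_sigma_additive nu.
  move=> A mA tA mUA.
  have mDA k : measurable (D `&` F @^-1` A k) by exact: mF.
  rewrite [X in _ --> X](_ : _ = \sum_(i <oo) nu (A i)).
    by apply: is_cvg_ereal_nneg_natsum => k _; exact: nu_ge0.
  rewrite /nu preimage_bigcup setI_bigcupr ge0_integral_bigcup//.
  - apply/measurable_EFinP; apply: measurable_funS mw => //.
    by move=> x [k _ []].
  - by move=> x [k _ [Dx _]]; rewrite lee_fin w0.
  - by apply: trivIset_setIl => i j _ _ [x [Ax Ay]]; apply: tA => //;
    exists (F x).
by exists (HB.pack_for {measure set T' -> \bar R} nu
  (isMeasure.Build _ _ _ nu nu0 nu_ge0 nu_sa)).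
Qed.

Import HBNNSimple.

(** By monotone convergence along simple functions increasing to [v], it suffices to treat a simple
    function, where both sides become the same finite sum over its values. *)
Lemma ge0_integral_weighted_pushforward (nu : {measure set T' -> \bar R})
    (v : T' -> \bar R) :
  (forall A, nu A = \int[mu]_(x in D `&` F @^-1` A) (w x)%:E) ->
  measurable_fun setT v -> (forall y, 0 <= v y) ->
  \int[nu]_y v y = \int[mu]_(x in D) (v (F x) * (w x)%:E).
Proof.
move=> nuE mv v0.
pose v_ := nnsfun_approx measurableT mv.
have mwE : measurable_fun D (EFin \o w) by exact/measurable_EFinP.
have mv_F n : measurable_fun D (fun x => v_ n (F x)).
  by apply: (measurable_comp measurableT) mF => //; exact: measurable_funP.
transitivity (limn (fun n => \int[nu]_x (v_ n x)%:E)).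
  rewrite -monotone_convergence//.
  - apply: eq_integral => y _; apply/esym/cvg_lim => //.
    by apply: cvg_nnsfun_approx => // *; exact: v0.
  - by move=> n; exact/measurable_EFinP/measurable_funP.
  - by move=> n y _; rewrite lee_fin.
  - by move=> y _ m n mn; rewrite lee_fin; exact/lefP/nd_nnsfun_approx.
transitivity (limn (fun n => \int[mu]_(x in D) ((v_ n (F x))%:E * (w x)%:E)));
    last first.
  rewrite -monotone_convergence//.
  - apply: eq_integral => x /[!inE] Dx; apply/cvg_lim => //.
    apply: cvgeZr => //.
    by apply: cvg_nnsfun_approx => // *; exact: v0.
  - by move=> n; apply: emeasurable_funM => //; exact/measurable_EFinP.
  - by move=> n x Dx; rewrite mule_ge0// lee_fin// w0.
  - move=> x Dx m n mn; rewrite lee_wpmul2r ?lee_fin ?w0//.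
    exact/lefP/nd_nnsfun_approx.
apply/congr_lim/funext => n.
have mpre r : measurable (v_ n @^-1` [set r]) by [].
transitivity (\sum_(k \in range (v_ n)) k%:E * nu (v_ n @^-1` [set k])).
  by rewrite integralT_nnsfun sintegralE.
under [RHS]eq_integral => x Dx.
  rewrite fimfunE -fsumEFin// ge0_mule_fsuml; last first.
    by move=> r; exact: nnfun_muleindic_ge0.
  over.
rewrite ge0_integral_fsum//; last 2 first.
- move=> r; apply: emeasurable_funM => //; apply/measurable_EFinP.
  apply: (measurable_comp measurableT
    (f := fun y => r * \1_(v_ n @^-1` [set r]) y)%R) => //.
  exact: measurable_funM.
- move=> r x Dx; rewrite mule_ge0 ?lee_fin ?w0//; exact: nnfun_muleindic_ge0.
(* The sums agree term by term: integrating [w] against the indicator of a level set pulled back by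
   [F] gives the [nu]-mass of that level set. *)
apply: eq_fsbigr => r /[!inE] -[y _ <-].
under eq_integral do rewrite EFinM -muleA.
rewrite ge0_integralZl_EFin//.
- rewrite nuE integral_mkcondr; congr (_ * _).
  apply: eq_integral => x _; rewrite patchE/= indicE.
  have -> : (x \in F @^-1` (v_ n @^-1` [set v_ n y])) =
            (F x \in v_ n @^-1` [set v_ n y]) by apply/idP/idP; rewrite !inE.
  by case: (_ \in _); rewrite ?mul1e ?mul0e.
- by move=> x Dx; rewrite mule_ge0 ?lee_fin ?w0.
- apply: emeasurable_funM => //; apply/measurable_EFinP.
  exact: (measurable_comp measurableT
    (f := \1_(v_ n @^-1` [set v_ n y]) : T' -> R)).
Qed.

End weighted_pushforward.

Lemma open_itv_open (R : realType) (a b : \bar R) : open (open_itv a b : set R).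
Proof. by apply: openI; [exact: open_ereal_gt|exact: open_ereal_lt]. Qed.

Lemma measurable_open_itv (R : realType) (a b : \bar R) :
  measurable (open_itv a b : set R).
Proof. by apply: open_measurable; exact: open_itv_open. Qed.

Section substitution.
Local Open Scope ereal_scope.
Context (R : realType) (U : set R) (F w : R -> R) (zeta : \bar R).
Notation mu := lebesgue_measure.
Notation V := (open_itv 0 zeta).
Hypotheses (mU : measurable U) (mF : measurable_fun U F).
Hypotheses (mw : measurable_fun U w) (w0 : forall x, U x -> (0 <= w x)%R).
Hypothesis FV : forall x, U x -> V (F x).
Hypothesis Fw : forall c, V c ->
  \int[mu]_(x in U `&` F @^-1` `]-oo, c[) (w x)%:E = c%:E.

(* [R] and [measurableTypeR R] have the same measurable sets but distinct
   structures, and [lebesgue_measure] is a measure on the latter. *)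
Lemma weighted_pushforward_lebesgue
    (nu : {measure set (measurableTypeR R) -> \bar R}) :
  (forall A, nu A = \int[mu]_(x in U `&` F @^-1` A) (w x)%:E) ->
  forall A, measurable A -> nu A = mu (A `&` V).
Proof.
move=> nuE A mA.
have mV : measurable V := measurable_open_itv _ 0 zeta.
pose lam : {measure set (measurableTypeR R) -> \bar R} := mrestr mu mV.
(* Both measures are carried by [V]: [nu] because [F] maps [U] into [V], [lam] by restriction. They
   may therefore be compared on traces on [V]. *)
have nuV B : nu B = nu (B `&` V).
  rewrite !nuE; congr (\int[mu]_(x in _) _); apply/seteqP; split=> x.
    by case=> Ux Bx; split => //; split => //; exact: FV.
  by case=> Ux [Bx _].
have lamV B : lam B = lam (B `&` V) by rewrite /lam/= /mrestr -setIA setIid.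
have nulam0 c : V c -> nu `]-oo, c[%classic = lam `]-oo, c[%classic.
  move=> Vc; have [c0 cz] := Vc; rewrite nuE Fw// /lam/= /mrestr.
  rewrite [X in mu X](_ : _ = `]0%R, c[%classic).
    by rewrite lebesgue_measure_itv/= c0 sube0.
  apply/seteqP; split=> t /=; rewrite /open_itv/= !in_itv/= lte_fin.
    by case=> tc [-> _].
  move=> /andP[t0 tc]; split=> //; split=> //.
  by apply: lt_trans cz; rewrite lte_fin.
(* The remaining rays: both masses vanish when [c <= 0] or when [V] is empty, which leaves a finite
   positive [zeta] with [zeta <= c]. *)
have nulam c : nu `]-oo, c[%classic = lam `]-oo, c[%classic.
  have [c0|c0] := leP c 0%R.
    rewrite nuV lamV.
    rewrite [X in nu X](_ : _ = set0) ?[X in lam X](_ : _ = set0) ?measure0//;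
    by apply/seteqP; split => // t [/=]; rewrite in_itv/= => tc [];
      rewrite lte_fin => /lt_trans/(_ tc); rewrite ltNge c0.
  have [cz|] := ltP c%:E zeta; first by apply: nulam0; split; rewrite ?lte_fin.
  case zE : zeta => [z| |]; last 2 first.
  - by rewrite leye_eq.
  - move=> _; rewrite nuV lamV.
    rewrite [X in nu X](_ : _ = set0) ?[X in lam X](_ : _ = set0) ?measure0//;
    by apply/seteqP; split => // t [_ []]; rewrite zE.
  rewrite lee_fin => zc.
  have [z0|z0] := leP z 0%R.
    rewrite nuV lamV.
    rewrite [X in nu X](_ : _ = set0) ?[X in lam X](_ : _ = set0) ?measure0//;
    by apply/seteqP; split => // t [_ []]; rewrite zE !lte_fin;
      move=> /lt_trans/[apply]; rewrite ltNge z0.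
  (* Only rays with c < zeta are covered by [Fw]; for c >= zeta both masses
     are the limits along e n, which increases to zeta. *)
  pose e n := (z - z / n.+2%:R)%R.
  have eE : `]-oo, c[%classic `&` V =
      \bigcup_n (`]-oo, (e n)[%classic `&` V).
    rewrite -setI_bigcupl; apply/seteqP; split=> t [].
      move=> _ Vt; split => //; have [t0 tz] := Vt.
      move: tz; rewrite zE lte_fin -subr_gt0 => tz.
      (* The inequality [t < e n] amounts to [z / (z - t) < n + 2], which the integer part of the
         quotient satisfies. *)
      exists (Num.truncn (z / (z - t))) => //=; rewrite in_itv/=.
      rewrite ltrBrDl -ltrBrDr ltr_pdivrMr// mulrC -ltr_pdivrMr//.
      by rewrite (lt_trans (truncnS_gt _))// ltr_nat.
    move=> [n _ /=]; rewrite !in_itv/= => ten Vt; split => //.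
    by have [_] := Vt; rewrite zE lte_fin => /lt_le_trans; exact.
  (* The shift [n.+2] makes [e 0 = z / 2] positive; with [n.+1] the first term would be 0, outside
     [V]. *)
  have ze n : V (e n).
    split; rewrite ?zE lte_fin /e; last by rewrite ltrBlDr ltrDl divr_gt0.
    by rewrite subr_gt0 ltr_pdivrMr// ltr_pMr// ltr1n.
  have cvg_e (m : {measure set (measurableTypeR R) -> \bar R}) :
      m (`]-oo, (e n)[%classic `&` V) @[n --> \oo] -->
      m (`]-oo, c[%classic `&` V).
    rewrite eE; apply: nondecreasing_cvg_mu.
    - by move=> n; apply: measurableI => //; exact: measurable_open_itv.
    - apply: bigcupT_measurable => n.
      by apply: measurableI => //; exact: measurable_open_itv.
    - move=> m1 m2 m12; apply/subsetPset; apply: setSI => t /=.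
      rewrite !in_itv/= => /lt_le_trans; apply.
      by rewrite lerD2l lerN2 ler_pM2l// lef_pV2 ?posrE// ler_nat !ltnS.
  rewrite nuV lamV; apply: cvg_unique (cvg_e nu) _ => //.
  rewrite (_ : (fun n => _) =
    (fun n => lam (`]-oo, (e n)[%classic `&` V))); first exact: cvg_e.
  by apply/funext => n; rewrite -nuV -lamV nulam0.
rewrite -[RHS]/(lam A).
have mG : @measurable _ (measurableTypeR R) =
    <<s @RGenInftyO.G R >> by exact: RGenInftyO.measurableE.
(* Uniqueness of measures: the rays are stable under intersection and generate the Borel sets, and
   those with natural endpoints exhaust the line with finite mass. *)
apply: (@measure_unique _ R (measurableTypeR R) _
  (fun k => `]-oo, k%:R[%classic) mG) => //.
- move=> _ _ [x ->] [y ->]; exists (Num.min x y).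
  by apply/seteqP; split=> t /=; rewrite !in_itv/= lt_min => /andP.
- by move=> k; exists k%:R.
- rewrite -subTset => t _; exists (Num.truncn `|t|).+1 => //=.
  by rewrite in_itv/= (le_lt_trans (ler_norm _))// truncnS_gt.
- by move=> _ [x ->].
(* The mass is finite because the trace of the ray on [V] lies in []0, k[]. *)
- move=> k; rewrite nulam /lam/= /mrestr.
  rewrite (@le_lt_trans _ _ (mu `]0%R, k%:R[%classic))//.
    apply: le_measure; rewrite ?inE//; first exact: measurableI.
    by move=> t [/=]; rewrite !in_itv/= => tk [+ _];
      rewrite lte_fin => ->; rewrite tk.
  by rewrite lebesgue_measure_itv/=; case: ifPn => //; rewrite sube0 ltry.
Qed.

Lemma ge0_integral_substitution (v : R -> R) :
  measurable_fun V v -> (forall y, V y -> (0 <= v y)%R) ->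
  \int[mu]_(x in U) (v (F x) * w x)%:E = \int[mu]_(y in V) (v y)%:E.
Proof.
pose RM := measurableTypeR R.
move=> mv v0; have [nu nuE] :=
  @weighted_pushforward_exists _ _ RM RM R mu U F w mU mF mw w0.
have mV : measurable V := measurable_open_itv _ 0 zeta.
transitivity (\int[nu]_(y in V) (v y)%:E); last first.
  apply: eq_measure_integral => A mA AV.
  by rewrite weighted_pushforward_lebesgue// setIidl.
rewrite [RHS]integral_mkcond.
rewrite (@ge0_integral_weighted_pushforward _ _ RM RM R mu U F w
  mU mF mw w0 nu _ nuE).
- apply: eq_integral => x /[!inE] Ux.
  by rewrite patchE mem_set ?EFinM//; exact: FV.
- by apply/(measurable_restrictT _ mV)/measurable_EFinP.
- by apply: erestrict_ge0 => y Vy; rewrite lee_fin v0.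
Qed.

Lemma integrable_substitution (u : R -> R) : measurable_fun V u ->
  mu.-integrable V (EFin \o u) ->
  mu.-integrable U (fun x => (u (F x) * w x)%:E).
Proof.
move=> mu_ iu; have mV : measurable V := measurable_open_itv _ 0 zeta.
have muF : measurable_fun U (u \o F).
  by apply: (measurable_comp mV) => // _ [x Ux <-]; exact: FV.
apply/integrableP; split; first by apply/measurable_EFinP; exact: measurable_funM.
move/integrableP : iu => [_]; apply: le_lt_trans.
rewrite -(ge0_integral_substitution (fun y => `|u y|)%R)//.
- apply: ge0_le_integral => //.
  + by apply/measurable_EFinP/measurableT_comp => //; exact: measurable_funM.
  + apply/measurable_EFinP; apply: measurable_funM => //.
    exact: measurableT_comp muF.
  + by move=> x Ux; rewrite lee_fin normrM (ger0_norm (w0 x Ux)).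
- exact: measurableT_comp.
Qed.

(** The nonnegative case applies to the positive and negative parts separately, and [w >= 0] lets
    the weight move inside each maximum. No integrability is required, since the two differences
    agree even with infinite terms. *)
Lemma integral_substitution (u : R -> R) : measurable_fun V u ->
  \int[mu]_(x in U) (u (F x) * w x)%:E = \int[mu]_(y in V) (u y)%:E.
Proof.
move=> mu_; rewrite integralE [RHS]integralE.
have <- : \int[mu]_(x in U) (Num.max (u (F x)) 0 * w x)%:E =
    \int[mu]_(x in V) (EFin \o u)^\+ x.
  rewrite (ge0_integral_substitution (fun y => Num.max (u y) 0)%R)//.
  - by apply: eq_integral => y _; rewrite funeposE/= EFin_max.
  - exact: measurable_funrpos.
  - by move=> y _; rewrite le_max lexx orbT.
have <- : \int[mu]_(x in U) (Num.max (- u (F x)) 0 * w x)%:E =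
    \int[mu]_(x in V) (EFin \o u)^\- x.
  rewrite (ge0_integral_substitution (fun y => Num.max (- u y) 0)%R)//.
  - by apply: eq_integral => y _; rewrite funenegE/= EFin_max.
  - exact: measurable_funrneg.
  - by move=> y _; rewrite le_max lexx orbT.
congr (_ - _); apply: eq_integral => x /[!inE] Ux.
  by rewrite funeposE/= maxr_pMl ?w0// mul0r EFin_max.
by rewrite funenegE/= maxr_pMl ?w0// mul0r mulNr EFin_max.
Qed.

End substitution.

(** * Monotonicity of Bregman divergences *)

Section bregman_monotonicity.
Context (R : realType) (a b : \bar R) (phi : R -> R).
Notation I := (open_itv a b).
Hypothesis phi_convex : strictly_convex_on I phi.
Hypothesis dphi : forall x, I x -> derivable phi x 1.

Lemma open_itv_between (x y z : R) : I x -> I z -> x <= y <= z -> I y.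
Proof.
move=> [ax _] [_ zb] /andP[xy yz]; split.
  by rewrite (lt_le_trans ax)// lee_fin.
by rewrite (le_lt_trans _ zb)// lee_fin.
Qed.

(** Along the segment from [x] to [y], convexity bounds the right difference quotients at 0 by
    [phi y - phi x]; they tend to the left-hand side. Strictness is lost in the limit. *)
Lemma strictly_convex_tangent_le (x y : R) : I x -> I y ->
  derive1 phi x * (y - x) <= phi y - phi x.
Proof.
move=> Ix Iy; have [->|xy] := eqVneq x y; first by rewrite !subrr mulr0.
pose psi (t : R) := phi (t * (y - x) + x).
have dpsi : is_derive (0 : R) 1 psi (derive1 phi x * (y - x)).
  apply: (@is_derive1_comp _ phi (fun t => t * (y - x) + x)).
    rewrite mul0r add0r derive1E; apply: DeriveDef => //; exact: dphi.
  apply: is_derive_eq; rewrite /GRing.scale/=.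
  by rewrite ?(mulr1, mulr0, addr0, add0r).
have cpsi : h^-1 *: (psi h - psi 0) @[h --> 0^'+] --> derive1 phi x * (y - x).
  apply: cvg_dnbhs_at_right; rewrite -(@derive_val _ _ _ _ _ _ _ dpsi) /derive.
  rewrite (_ : (fun h => _) =
    (fun h => h^-1 *: ((psi \o shift 0) (h *: 1) - psi 0))); last first.
    by apply/funext => h; rewrite /= addr0 /GRing.scale/= mulr1.
  exact: (@ex_derive _ _ _ _ _ _ _ dpsi).
apply: (cvgr_to_le cpsi); near=> t.
have t0 : 0 < t by near: t; exact: nbhs_right_gt.
have t1 : t < 1 by near: t; exact: nbhs_right_lt.
rewrite /GRing.scale/= ler_pdivrMl// /psi mul0r add0r.
have := phi_convex y x t Iy Ix; rewrite eq_sym => /(_ xy); rewrite t0 t1 => /(_ isT).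
rewrite (_ : t * y + (1 - t) * x = t * (y - x) + x); last by ring.
by move=> H; lra.
Unshelve. all: by end_near. Qed.

(** Strictness is recovered at the midpoint [m]: the tangent at [x] lies weakly below [phi] at [m],
    and [phi m] is strictly below the chord. *)
Lemma bregman_gt0 (x y : R) : I x -> I y -> x != y -> 0 < bregman phi y x.
Proof.
move=> Ix Iy xy; pose m := 2^-1 * x + (1 - 2^-1) * y.
have Im : I m.
  have [xley|/ltW ylex] := leP x y.
    by apply: (open_itv_between _ _ _ Ix Iy); rewrite /m; apply/andP; split; lra.
  by apply: (open_itv_between _ _ _ Iy Ix); rewrite /m; apply/andP; split; lra.
have := strictly_convex_tangent_le x m Ix Im.
have h01 : 0 < (2^-1 : R) < 1 by apply/andP; split; lra.
have := phi_convex x y 2^-1 Ix Iy xy h01.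
rewrite -/m /bregman (_ : m - x = (y - x) / 2); last by rewrite /m; field.
set p := derive1 phi x => A B.
have : p * ((y - x) / 2) = (p * (y - x)) / 2 by rewrite mulrA.
by lra.
Qed.

(** Three-point identity. For [th <= x < y] and for [y < x <= th] the last product is nonnegative
    and [bregman phi y x] is positive, whence the strict monotonicity on either side of [th]. *)
Lemma bregman_sub (x y th : R) : bregman phi y th - bregman phi x th =
  bregman phi y x + (derive1 phi x - derive1 phi th) * (y - x).
Proof. by rewrite /bregman; ring. Qed.

(** The symmetrized divergence equals the product of the increments of [derive1 phi] and of the
    argument, and it is positive. *)
Lemma strictly_convex_derive1_lt (x y : R) : I x -> I y -> x < y ->
  derive1 phi x < derive1 phi y.
Proof.
move=> Ix Iy xy; rewrite -subr_gt0 -(@pmulr_lgt0 _ (y - x)) ?subr_gt0//.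
have -> : (derive1 phi y - derive1 phi x) * (y - x) =
  bregman phi y x + bregman phi x y by rewrite /bregman; ring.
by rewrite addr_gt0// bregman_gt0// ?(lt_eqF xy)// gt_eqF.
Qed.

Lemma strictly_convex_derive1_le (x y : R) : I x -> I y -> x <= y ->
  derive1 phi x <= derive1 phi y.
Proof.
by move=> Ix Iy; rewrite le_eqVlt => /predU1P[->//|xy]; exact/ltW/strictly_convex_derive1_lt.
Qed.

Lemma bregman_increasing (th x y : R) : I th -> I y -> th <= x -> x < y ->
  bregman phi x th < bregman phi y th.
Proof.
move=> Ith Iy thx xy.
have Ix : I x by apply: (open_itv_between _ _ _ Ith Iy); rewrite thx ltW.
rewrite -subr_gt0 bregman_sub ltr_wpDr ?bregman_gt0 ?lt_eqF//.
by rewrite mulr_ge0// subr_ge0 ?strictly_convex_derive1_le// ltW.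
Qed.

Lemma bregman_decreasing (th x y : R) : I th -> I y -> x <= th -> y < x ->
  bregman phi x th < bregman phi y th.
Proof.
move=> Ith Iy xth yx.
have Ix : I x by apply: (open_itv_between _ _ _ Iy Ith); rewrite xth ltW.
rewrite -subr_gt0 bregman_sub ltr_wpDr ?bregman_gt0 ?gt_eqF//.
by rewrite mulr_le0// subr_le0 ?strictly_convex_derive1_le// ltW.
Qed.

Lemma is_derive_bregman (th x : R) : I x ->
  is_derive x 1 (fun y => bregman phi y th) (derive1 phi x - derive1 phi th).
Proof.
move=> Ix; have dx : is_derive x 1 phi (derive1 phi x).
  by rewrite derive1E; apply: DeriveDef => //; exact: dphi.
rewrite /bregman.
apply: is_derive_eq; rewrite /GRing.scale/=.
by rewrite ?(mulr1, mulr0, addr0, add0r, subr0, oppr0).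
Qed.

End bregman_monotonicity.
Arguments open_itv_between {R a b x y z}.
Arguments bregman_gt0 {R a b phi} phi_convex dphi {x y}.
Arguments strictly_convex_derive1_le {R a b phi} phi_convex dphi {x y}.
Arguments bregman_increasing {R a b phi} phi_convex dphi {th x y}.
Arguments bregman_decreasing {R a b phi} phi_convex dphi {th x y}.
Arguments is_derive_bregman {R a b phi} dphi th {x}.

(** * Substitution t = d_phi(x, th) on both sides of th *)

#[local] Instance left_end_filter_proper (R : realType) (a : \bar R) :
  ProperFilter (left_end_filter a).
Proof. by case: a => [r| |]; rewrite /left_end_filter; exact _. Qed.

#[local] Instance right_end_filter_proper (R : realType) (b : \bar R) :
  ProperFilter (right_end_filter b).
Proof. by case: b => [r| |]; rewrite /right_end_filter; exact _. Qed.

(** The hypothesis excludes [a = +oo], for which [left_end_filter] only takes a default value. *)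
Lemma near_left_end (R : realType) (a : \bar R) (y : R) : (a < y%:E)%E ->
  \forall x \near left_end_filter a, open_itv a y%:E x.
Proof.
case: a => [r| |_]; rewrite /left_end_filter.
- rewrite lte_fin => ry; near=> x; split; rewrite lte_fin; near: x.
    exact: nbhs_right_gt.
  exact: nbhs_right_lt.
- by rewrite ltNge leey.
near=> x; split; rewrite ?ltNyr// lte_fin; near: x.
by apply: nbhs_ninfty_lt; exact: num_real.
Unshelve. all: by end_near. Qed.

Lemma near_right_end (R : realType) (b : \bar R) (y : R) : (y%:E < b)%E ->
  \forall x \near right_end_filter b, open_itv y%:E b x.
Proof.
case: b => [r|_|]; rewrite /right_end_filter; last by rewrite ltNge leNye.
  rewrite lte_fin => ry; near=> x; split; rewrite lte_fin; near: x.
    exact: nbhs_left_gt.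
  exact: nbhs_left_lt.
near=> x; split; rewrite ?ltry// lte_fin; near: x.
by apply: nbhs_pinfty_gt; exact: num_real.
Unshelve. all: by end_near. Qed.

Section bregman_substitution.
Context (R : realType) (a b : \bar R) (phi : R -> R) (zeta : \bar R) (th : R).
Notation I := (open_itv a b).
Notation D := (fun x => bregman phi x th).
Notation mu := lebesgue_measure.
Hypothesis phi_convex : strictly_convex_on I phi.
Hypothesis dphi : forall x, I x -> derivable phi x 1.
Hypothesis cphi : forall x, I x -> {for x, continuous (derive1 phi)}.
Hypothesis Ith : I th.

Lemma bregmanxx : bregman phi th th = 0.
Proof. by rewrite /bregman !subrr mulr0 subr0. Qed.

Lemma sub_open_itv_left x : open_itv a th%:E x -> I x.
Proof. by case=> ax xth; split => //; apply: lt_trans xth Ith.2. Qed.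

Lemma sub_open_itv_right x : open_itv th%:E b x -> I x.
Proof. by case=> thx xb; split => //; apply: lt_trans Ith.1 thx. Qed.

Lemma continuous_bregman x : I x -> {for x, continuous D}.
Proof.
move=> Ix; apply: differentiable_continuous; apply/derivable1_diffP.
exact: (@ex_derive _ _ _ _ _ _ _ (is_derive_bregman dphi th Ix)).
Qed.

Lemma continuous_derive1_sub x : I x ->
  {for x, continuous (fun y => derive1 phi y - derive1 phi th)}.
Proof. by move=> Ix; apply: cvgB; [exact: cphi|exact: cvg_cst]. Qed.

Lemma within_continuous_bregman x y : I x -> I y ->
  {within `[x, y], continuous D}.
Proof.
move=> Ix Iy; apply: derivable_within_continuous => z; rewrite in_itv/= => xzy.
have Iz := open_itv_between Ix Iy xzy.
exact: (@ex_derive _ _ _ _ _ _ _ (is_derive_bregman dphi th Iz)).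
Qed.

Lemma integral_derive1_sub x y : I x -> I y -> x < y ->
  (\int[mu]_(z in `[x, y]) (derive1 phi z - derive1 phi th)%:E =
  (D y - D x)%:E)%E.
Proof.
move=> Ix Iy xy.
have Iz z : z \in `[x, y] -> I z.
  by rewrite in_itv/= => /(open_itv_between Ix Iy).
rewrite EFinB; apply: (@continuous_FTC2 R _ D) => //.
- apply: continuous_in_subspaceT => z /[!inE] /= zxy.
  exact/continuous_derive1_sub/Iz.
- split.
  + move=> z zxy; have {}Iz : I z by apply: Iz; exact: subset_itv_oo_cc.
    exact: (@ex_derive _ _ _ _ _ _ _ (is_derive_bregman dphi th Iz)).
  + exact/cvg_at_right_filter/continuous_bregman.
  + exact/cvg_at_left_filter/continuous_bregman.
- move=> z zxy; have {}Iz : I z by apply: Iz; exact: subset_itv_oo_cc.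
  rewrite derive1E.
  exact: (@derive_val _ _ _ _ _ _ _ (is_derive_bregman dphi th Iz)).
Qed.

Lemma measurable_bregman J : measurable J -> J `<=` I -> measurable_fun J D.
Proof.
move=> mJ JI; apply: (measurable_funS (measurable_open_itv _ a b) JI).
apply: open_continuous_measurable_fun; first exact: open_itv_open.
by move=> x /[!inE]; exact: continuous_bregman.
Qed.

Lemma measurable_derive1_sub J : measurable J -> J `<=` I ->
  measurable_fun J (fun x => derive1 phi x - derive1 phi th).
Proof.
move=> mJ JI; apply: (measurable_funS (measurable_open_itv _ a b) JI).
apply: open_continuous_measurable_fun; first exact: open_itv_open.
by move=> x /[!inE]; exact: continuous_derive1_sub.
Qed.

Section right_side.
Notation U := (open_itv th%:E b).
Hypothesis Dr : (fun x => (D x)%:E) @ right_end_filter b --> zeta.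

Lemma bregman_right_range x : U x -> open_itv 0 zeta (D x).
Proof.
move=> Ux; have Ix := sub_open_itv_right _ Ux; have [thx xb] := Ux.
split.
  rewrite lte_fin (bregman_gt0 phi_convex dphi)// lt_eqF//.
(* The limit only yields [D y <= zeta]; a point [y] strictly between [x] and [b] makes the bound at
   [x] strict. *)
have [y [xy yb]] : exists y, open_itv x%:E b y.
  exact: filter_ex (near_right_end _ _ _ xb).
have Uy : U y by split => //; exact: lt_trans xy.
have Iy := sub_open_itv_right _ Uy.
apply: (@lt_le_trans _ _ (D y)%:E).
  by rewrite lte_fin; apply: (bregman_increasing phi_convex dphi) => //;
    rewrite ltW.
apply: (cvge_to_ge Dr); near=> t.
have [yt tb] : open_itv y%:E b t by near: t; exact: near_right_end.
rewrite lee_fin ltW//; apply: (bregman_increasing phi_convex dphi) => //.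
- by apply: sub_open_itv_right; split => //; apply: lt_trans yt; exact: Uy.1.
- by rewrite ltW//; exact: Uy.1.
Unshelve. all: by end_near. Qed.

(** If [D] exceeds [c] somewhere on [U], the intermediate value theorem applies from [th], where [D]
    vanishes; otherwise the limit gives [zeta <= c]. *)
Lemma bregman_right_surj c : open_itv 0 zeta c -> exists2 z, U z & D z = c.
Proof.
move=> [+ cz]; rewrite lte_fin => c0.
have [[y Uy cy]|noy] := pselect (exists2 y, U y & c < D y).
  have Iy := sub_open_itv_right _ Uy; have [thy yb] := Uy.
  have [|z] := @IVT R D th y c (ltW thy) (within_continuous_bregman _ _ Ith Iy).
    by rewrite bregmanxx ge_min le_max (ltW c0) (ltW cy) orbT.
  rewrite in_itv/= => /andP[thz zy] Dz; exists z => //.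
  split; last by apply: le_lt_trans yb; rewrite lee_fin.
  rewrite lte_fin lt_neqAle thz andbT; apply/eqP => thE.
  by move: c0; rewrite -Dz -thE bregmanxx ltxx.
exfalso; move: cz; rewrite ltNge => /negP; apply.
apply: (cvge_to_le Dr); near=> t.
have Ut : U t by near: t; apply: near_right_end; exact: Ith.2.
by rewrite lee_fin leNgt; apply/negP => ct; apply: noy; exists t.
Unshelve. all: by end_near. Qed.

(** By monotonicity the sublevel set is []th, z[] with [D z = c], and the integral of [D'] over it
    is [D z - D th = c]. This is the ray condition [Fw] of the substitution lemmas. *)
Lemma integral_right_sublevel c : open_itv 0 zeta c ->
  (\int[mu]_(x in U `&` D @^-1` `]-oo, c[)
     (derive1 phi x - derive1 phi th)%:E = c%:E)%E.
Proof.
move=> Vc; have [z Uz Dz] := bregman_right_surj _ Vc; have [thz zb] := Uz.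
have Iz := sub_open_itv_right _ Uz.
rewrite (_ : _ `&` _ = `]th, z[%classic); last first.
  apply/seteqP; split => x /=; rewrite !in_itv/=.
    move=> [Ux xc]; have [+ _] := Ux; rewrite lte_fin => ->; rewrite ltNge/=.
    apply/negP => zx.
    move: xc; rewrite -Dz ltNge => /negP; apply; move: zx.
    rewrite le_eqVlt => /predU1P[->//|zx].
    apply/ltW/(bregman_increasing phi_convex dphi) => //.
      exact: sub_open_itv_right.
    exact: ltW.
  move=> /andP[thx xz]; split.
    by split; rewrite ?lte_fin//; apply: lt_trans zb; rewrite lte_fin.
  by rewrite -Dz; apply: (bregman_increasing phi_convex dphi) => //; exact: ltW.
have sub : `]th, z[ `<=` I.
  move=> x /=; rewrite in_itv/= => /andP[/ltW thx /ltW xz].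
  by apply: (open_itv_between Ith Iz); rewrite thx.
have sub' : `]th, z] `<=` I.
  move=> x /=; rewrite in_itv/= => /andP[/ltW thx xz].
  by apply: (open_itv_between Ith Iz); rewrite thx.
(* The endpoints are added because the fundamental theorem of calculus is applied on a closed
   interval. *)
rewrite integral_itv_bndo_bndc; last first.
  by apply/measurable_EFinP; apply: (measurable_derive1_sub _ _ sub).
rewrite integral_itv_obnd_cbnd; last first.
  by apply/measurable_EFinP; apply: (measurable_derive1_sub _ _ sub').
by rewrite integral_derive1_sub// bregmanxx subr0 Dz.
Qed.

Lemma derive1_sub_right_ge0 x : U x -> 0 <= derive1 phi x - derive1 phi th.
Proof.
move=> Ux; rewrite subr_ge0 (strictly_convex_derive1_le phi_convex dphi)//.
  exact: sub_open_itv_right.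
by rewrite ltW//; exact: Ux.1.
Qed.

Lemma integrable_bregman_right (u : R -> R) :
  measurable_fun (open_itv 0 zeta) u ->
  mu.-integrable (open_itv 0 zeta) (EFin \o u) ->
  mu.-integrable U (fun x => (u (D x) * (derive1 phi x - derive1 phi th))%:E).
Proof.
have mU : measurable U := measurable_open_itv _ _ _.
apply: integrable_substitution => //.
- by apply: measurable_bregman => // x; exact: sub_open_itv_right.
- by apply: measurable_derive1_sub => // x; exact: sub_open_itv_right.
- exact: derive1_sub_right_ge0.
- exact: bregman_right_range.
- exact: integral_right_sublevel.
Qed.

Lemma integral_bregman_right (u : R -> R) :
  measurable_fun (open_itv 0 zeta) u ->
  (\int[mu]_(x in U) (u (D x) * (derive1 phi x - derive1 phi th))%:E =
   \int[mu]_(t in open_itv 0 zeta) (u t)%:E)%E.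
Proof.
have mU : measurable U := measurable_open_itv _ _ _.
apply: integral_substitution => //.
- by apply: measurable_bregman => // x; exact: sub_open_itv_right.
- by apply: measurable_derive1_sub => // x; exact: sub_open_itv_right.
- exact: derive1_sub_right_ge0.
- exact: bregman_right_range.
- exact: integral_right_sublevel.
Qed.

End right_side.

Section left_side.
Notation U := (open_itv a th%:E).
Hypothesis Dl : (fun x => (D x)%:E) @ left_end_filter a --> zeta.

Lemma bregman_left_range x : U x -> open_itv 0 zeta (D x).
Proof.
move=> Ux; have Ix := sub_open_itv_left _ Ux; have [ax xth] := Ux.
split.
  by rewrite lte_fin (bregman_gt0 phi_convex dphi)// gt_eqF.
have [y [ay yx]] : exists y, open_itv a x%:E y.
  exact: filter_ex (near_left_end _ _ _ ax).
have Uy : U y by split => //; exact: lt_trans yx xth.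
have Iy := sub_open_itv_left _ Uy.
apply: (@lt_le_trans _ _ (D y)%:E).
  by rewrite lte_fin; apply: (bregman_decreasing phi_convex dphi) => //;
    rewrite ltW.
apply: (cvge_to_ge Dl); near=> t.
have [at_ ty] : open_itv a y%:E t by near: t; exact: near_left_end.
rewrite lee_fin ltW//; apply: (bregman_decreasing phi_convex dphi) => //.
- by apply: sub_open_itv_left; split => //; apply: (lt_trans ty); exact: Uy.2.
- by rewrite ltW//; exact: Uy.2.
Unshelve. all: by end_near. Qed.

Lemma bregman_left_surj c : open_itv 0 zeta c -> exists2 z, U z & D z = c.
Proof.
move=> [+ cz]; rewrite lte_fin => c0.
have [[y Uy cy]|noy] := pselect (exists2 y, U y & c < D y).
  have Iy := sub_open_itv_left _ Uy; have [ay yth] := Uy.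
  have [|z] := @IVT R D y th c (ltW yth) (within_continuous_bregman _ _ Iy Ith).
    by rewrite bregmanxx ge_min le_max (ltW c0) (ltW cy) orbT.
  rewrite in_itv/= => /andP[yz zth] Dz; exists z => //.
  split; first by apply: (lt_le_trans ay); rewrite lee_fin.
  rewrite lte_fin lt_neqAle zth andbT; apply/eqP => thE.
  by move: c0; rewrite -Dz thE bregmanxx ltxx.
exfalso; move: cz; rewrite ltNge => /negP; apply.
apply: (cvge_to_le Dl); near=> t.
have Ut : U t by near: t; apply: near_left_end; exact: Ith.1.
by rewrite lee_fin leNgt; apply/negP => ct; apply: noy; exists t.
Unshelve. all: by end_near. Qed.

(** As [D] decreases on this side, the nonnegative weight for the substitution is [- D']. *)
Lemma derive1_sub_left_ge0 x : U x -> 0 <= derive1 phi th - derive1 phi x.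
Proof.
move=> Ux; rewrite subr_ge0 (strictly_convex_derive1_le phi_convex dphi)//.
  exact: sub_open_itv_left.
by rewrite ltW//; exact: Ux.2.
Qed.

Lemma measurable_derive1_subC J : measurable J -> J `<=` I ->
  measurable_fun J (fun x => derive1 phi th - derive1 phi x).
Proof.
move=> mJ JI; rewrite (_ : (fun _ => _) =
  (fun x => - (derive1 phi x - derive1 phi th))); last first.
  by apply/funext => x; rewrite opprB.
by apply: measurableT_comp => //; exact: measurable_derive1_sub.
Qed.

Lemma integral_left_sublevel c : open_itv 0 zeta c ->
  (\int[mu]_(x in U `&` D @^-1` `]-oo, c[)
     (derive1 phi th - derive1 phi x)%:E = c%:E)%E.
Proof.
move=> Vc; have [z Uz Dz] := bregman_left_surj _ Vc; have [az zth] := Uz.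
have Iz := sub_open_itv_left _ Uz.
rewrite (_ : _ `&` _ = `]z, th[%classic); last first.
  apply/seteqP; split => x /=; rewrite !in_itv/=.
    move=> [Ux xc]; have [_ +] := Ux; rewrite lte_fin => ->; rewrite andbT ltNge/=.
    apply/negP => xz; move: xc; rewrite -Dz ltNge => /negP; apply; move: xz.
    rewrite le_eqVlt => /predU1P[->//|xz].
    apply/ltW/(bregman_decreasing phi_convex dphi) => //.
      exact: sub_open_itv_left.
    exact: ltW.
  move=> /andP[zx xth]; split.
    by split; rewrite ?lte_fin//; apply: (lt_trans az); rewrite lte_fin.
  by rewrite -Dz; apply: (bregman_decreasing phi_convex dphi) => //; exact: ltW.
have sub : `]z, th[ `<=` I.
  move=> x /=; rewrite in_itv/= => /andP[/ltW zx /ltW xth].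
  by apply: (open_itv_between Iz Ith); rewrite zx.
have sub' : `]z, th] `<=` I.
  move=> x /=; rewrite in_itv/= => /andP[/ltW zx xth].
  by apply: (open_itv_between Iz Ith); rewrite zx.
rewrite integral_itv_bndo_bndc; last first.
  by apply/measurable_EFinP; apply: (measurable_derive1_subC _ _ sub).
rewrite integral_itv_obnd_cbnd; last first.
  by apply/measurable_EFinP; apply: (measurable_derive1_subC _ _ sub').
(* Negating both sides turns the integrand back into [D'], whose integral over [[z, th]] is
   [D th - D z = - c]. *)
apply: oppe_inj; rewrite -integral_ge0N; last first.
  move=> x; rewrite /= in_itv/= => /andP[zx xth]; rewrite lee_fin subr_ge0.
  apply: (strictly_convex_derive1_le phi_convex dphi) => //.
  by apply: (open_itv_between Iz Ith); rewrite zx.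
under eq_integral do rewrite -EFinN opprB.
by rewrite integral_derive1_sub// bregmanxx sub0r Dz.
Qed.

Lemma integrable_bregman_left (u : R -> R) :
  measurable_fun (open_itv 0 zeta) u ->
  mu.-integrable (open_itv 0 zeta) (EFin \o u) ->
  mu.-integrable U (fun x => (u (D x) * (derive1 phi th - derive1 phi x))%:E).
Proof.
have mU : measurable U := measurable_open_itv _ _ _.
apply: integrable_substitution => //.
- by apply: measurable_bregman => // x; exact: sub_open_itv_left.
- by apply: measurable_derive1_subC => // x; exact: sub_open_itv_left.
- exact: derive1_sub_left_ge0.
- exact: bregman_left_range.
- exact: integral_left_sublevel.
Qed.

Lemma integral_bregman_left (u : R -> R) :
  measurable_fun (open_itv 0 zeta) u ->
  (\int[mu]_(x in U) (u (D x) * (derive1 phi th - derive1 phi x))%:E =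
   \int[mu]_(t in open_itv 0 zeta) (u t)%:E)%E.
Proof.
have mU : measurable U := measurable_open_itv _ _ _.
apply: integral_substitution => //.
- by apply: measurable_bregman => // x; exact: sub_open_itv_left.
- by apply: measurable_derive1_subC => // x; exact: sub_open_itv_left.
- exact: derive1_sub_left_ge0.
- exact: bregman_left_range.
- exact: integral_left_sublevel.
Qed.

End left_side.

End bregman_substitution.

(** * Measurability of derivatives *)

(** A derivative is a pointwise limit of difference quotients of a continuous, hence measurable,
    function. The increments [e n] are positive so that [e n + t] stays in the ray. *)
Lemma measurable_fun_is_derive_ray (R : realType) (r : R) (f df : R -> R) :
  (forall t, r < t -> is_derive t 1 f (df t)) ->
  measurable_fun (`]r, +oo[%classic : set R) df.
Proof.
move=> fdf; set A := `]r, +oo[%classic.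
have At t : A t = (r < t) :> Prop by rewrite /A/= in_itv/= andbT.
have mA : measurable A by exact: measurable_itv.
have mf : measurable_fun A f.
  apply: open_continuous_measurable_fun; first exact: interval_open.
  move=> t; rewrite inE At => rt; apply: differentiable_continuous.
  exact/derivable1_diffP/(@ex_derive _ _ _ _ _ _ _ (fdf t rt)).
pose e (n : nat) : R := n.+1%:R^-1.
have e0 n : 0 < e n by rewrite invr_gt0.
apply: (@measurable_fun_cvg _ _ _ _
  (fun n t => (e n)^-1 * (f (e n * 1 + t) - f t))).
  move=> n; apply: measurable_funM => //; apply: measurable_funB => //.
  apply: (measurable_comp (f := f) mA) => //.
    move=> _ [t + <-]; rewrite !At mulr1 => rt; apply: (lt_trans rt).
    by rewrite ltrDr.
  by apply: measurable_funD => //.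
move=> t; rewrite At => rt; have dt := fdf t rt.
have : h^-1 *: ((f \o shift t) (h *: 1) - f t) @[h --> 0^'] --> df t.
  rewrite -(@derive_val _ _ _ _ _ _ _ dt) /derive.
  exact: (@ex_derive _ _ _ _ _ _ _ dt).
move=> /cvg_dnbhs_at_right /cvg_at_rightP; apply; split => //.
exact: cvg_harmonic.
Qed.

(** * Cancellation of the two halves of the estimating integral *)

Theorem mainTheorem3 (R : realType) (a b : \bar R) (phi : R -> R)
  (zeta : \bar R) (g f df : R -> R) (theta C : R) :
  (a < b)%E ->
  (* phi strictly convex and continuously differentiable on (a,b) *)
  strictly_convex_on (open_itv a b) phi ->
  (forall x : R, open_itv a b x -> derivable phi x 1) ->
  (forall x : R, open_itv a b x -> {for x, continuous (derive1 phi)}) ->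
  (* boundary behaviour of d_phi, with zeta in (0, +oo] *)
  (0 < zeta)%E ->
  (forall th : R, open_itv a b th ->
     (fun x : R => (bregman phi x th)%:E) @ left_end_filter a --> zeta /\
     (fun x : R => (bregman phi x th)%:E) @ right_end_filter b --> zeta) ->
  (* g : [0,oo) -> [0,oo) measurable *)
  measurable_fun (`[0%R, +oo[%classic : set R) g ->
  (forall t : R, 0 <= t -> 0 <= g t) ->
  (* theta in (a,b) and C = C(theta) in (0,oo) is the normalizing constant *)
  open_itv a b theta ->
  0 < C ->
  (\int[lebesgue_measure]_(x in open_itv a b)
      (bregman_ratio phi x theta * g (bregman phi x theta))%:E = C%:E)%E ->
  (* f differentiable on [0,oo) with derivative df (one-sided at 0) *)
  (forall t : R, 0 < t -> is_derive t 1 f (df t)) ->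
  (fun h : R => h^-1 * (f h - f 0)) @ at_right 0 --> df 0 ->
  (* integrability hypothesis *)
  (\int[lebesgue_measure]_(t in (`[0%R, +oo[%classic : set R)) (g t * `|df t|)%:E < +oo)%E ->
  (* conclusion: the estimating equation is unbiased *)
  let h := fun x : R => bregman_density phi g C x theta
                    * df (bregman phi x theta) * (x - theta) in
  lebesgue_measure.-integrable (open_itv a b) (EFin \o h) /\
  (\int[lebesgue_measure]_(x in open_itv a b) (h x)%:E = 0)%E.
Proof.
move=> _ phi_convex dphi cphi _ Dlim mg g0 Ith C0 _ fdf _ gdf_fin h.
have [Dl Dr] := Dlim _ Ith.
pose V := open_itv 0 zeta.
pose u (t : R) := g t * df t.
have mV : measurable V := measurable_open_itv _ _ _.
pose R0 := `[0, +oo[%classic : set R.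
have mdf : measurable_fun R0 df.
  (* Adding the single point 0 to the open ray preserves measurability. *)
  apply/measurable_fun_itv_obnd_cbndP.
  exact: (measurable_fun_is_derive_ray _ _ f).
have V0 : V `<=` R0.
  by move=> t [+ _]; rewrite lte_fin /R0/= in_itv/= andbT; exact: ltW.
have m0y : measurable R0 by exact: measurable_itv.
have mu_ : measurable_fun V u.
  by apply: (measurable_funS m0y V0); exact: measurable_funM.
have iu : lebesgue_measure.-integrable V (EFin \o u).
  apply/integrableP; split; first exact/measurable_EFinP.
  apply: le_lt_trans gdf_fin.
  rewrite [leLHS](_ : _ = \int[lebesgue_measure]_(t in V) (g t * `|df t|)%:E)%E.
    apply: ge0_subset_integral => //.
    - apply/measurable_EFinP; apply: measurable_funM => //.
      exact: measurableT_comp.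
    - move=> t; rewrite /R0/= in_itv/= andbT => t0.
      by rewrite lee_fin mulr_ge0// g0.
  apply: eq_integral => t; rewrite inE => /V0.
  rewrite /R0/= in_itv/= andbT => t0.
  by rewrite normrM ger0_norm// g0.
pose Ul := open_itv a theta%:E; pose Ur := open_itv theta%:E b.
have mUl : measurable Ul := measurable_open_itv _ _ _.
have mUr : measurable Ur := measurable_open_itv _ _ _.
have hr x : x \in Ur -> ((C^-1)%:E * (u (bregman phi x theta) *
    (derive1 phi x - derive1 phi theta))%R%:E)%E = (EFin \o h) x.
  rewrite inE => -[+ _]; rewrite lte_fin => thx.
  have xth : x - theta != 0 by rewrite subr_eq0 gt_eqF.
  rewrite /= -EFinM; congr EFin; rewrite /h /bregman_density /bregman_ratio /u.
  by field; rewrite xth gt_eqF.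
(* The weight on the left is [- D'], which accounts for the opposite sign of the constant. *)
have hl x : x \in Ul -> ((- C^-1)%R%:E * (u (bregman phi x theta) *
    (derive1 phi theta - derive1 phi x))%R%:E)%E = (EFin \o h) x.
  rewrite inE => -[_ +]; rewrite lte_fin => thx.
  have xth : x - theta != 0 by rewrite subr_eq0 lt_eqF.
  rewrite /= -EFinM; congr EFin; rewrite /h /bregman_density /bregman_ratio /u.
  by field; rewrite xth gt_eqF.
have iUr :=
  integrable_bregman_right _ _ _ _ _ _ phi_convex dphi cphi Ith Dr u mu_ iu.
have iUl :=
  integrable_bregman_left _ _ _ _ _ _ phi_convex dphi cphi Ith Dl u mu_ iu.
have ihr : lebesgue_measure.-integrable Ur (EFin \o h).
  apply: (@eq_integrable _ (measurableTypeR R) R lebesgue_measure _ mUr _ _ hr).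
  exact: (integrableZl _ C^-1 iUr).
have ihl : lebesgue_measure.-integrable Ul (EFin \o h).
  apply: (@eq_integrable _ (measurableTypeR R) R lebesgue_measure _ mUl _ _ hl).
  exact: (integrableZl _ (- C^-1) iUl).
(* The point [theta], where the ratio divides by 0, is a null set; without it the interval is the
   disjoint union of the two halves. *)
have UE : open_itv a b `\ theta = Ul `|` Ur.
  apply/seteqP; split => x.
    move=> [[ax xb] /= /eqP]; rewrite neq_lt => /orP[xth|thx].
      by left; split; rewrite ?lte_fin.
    by right; split; rewrite ?lte_fin.
  move=> [Ux|Ux]; split.
  - exact: (sub_open_itv_left _ _ _ _ Ith).
  - by move=> /= xth; have [_] := Ux; rewrite xth ltxx.
  - exact: (sub_open_itv_right _ _ _ _ Ith).
  - by move=> /= xth; have [] := Ux; rewrite xth ltxx.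
have mU : measurable (open_itv a b `\ theta).
  by rewrite UE; exact: measurableU.
have mhU : measurable_fun (Ul `|` Ur) (EFin \o h).
  apply/measurable_funU => //.
  by split; [case/integrableP: ihl|case/integrableP: ihr].
have dU : [disjoint Ul & Ur].
  apply/disj_setPS => x [[_ +] [+ _]].
  by move=> /lt_trans /[apply]; rewrite ltxx.
have mhI : measurable_fun (open_itv a b) (EFin \o h).
  rewrite -(setD1K Ith) setUC; apply/measurable_funU => //.
  by split; [rewrite UE|exact: measurable_fun_set1].
split.
  apply/integrableP; split => //.
  rewrite -(integral_setD1 (r := theta))//; last first.
    by rewrite UE; exact: measurableT_comp.
  rewrite UE ge0_integral_setU//; last exact: measurableT_comp.
  by rewrite lte_add_pinfty//; [case/integrableP: ihl|case/integrableP: ihr].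
rewrite -(integral_setD1 (r := theta))//; last by rewrite UE.
rewrite UE integral_setU//.
have -> : (\int[lebesgue_measure]_(x in Ul) (h x)%:E =
    (- C^-1)%:E * \int[lebesgue_measure]_(t in V) (u t)%:E)%E.
  rewrite -(integral_bregman_left _ _ _ _ _ _ phi_convex dphi cphi Ith Dl)//.
  by rewrite -integralZl//; apply: eq_integral => x xU; exact/esym/hl.
have -> : (\int[lebesgue_measure]_(x in Ur) (h x)%:E =
    (C^-1)%:E * \int[lebesgue_measure]_(t in V) (u t)%:E)%E.
  rewrite -(integral_bregman_right _ _ _ _ _ _ phi_convex dphi cphi Ith Dr)//.
  by rewrite -integralZl//; apply: eq_integral => x xU; exact/esym/hr.
(* Finiteness, from the integrability of [u], rules out a difference of infinities, so the two
   opposite multiples cancel. *)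
have /fineK <- : (\int[lebesgue_measure]_(t in V) (u t)%:E)%E \is a fin_num.
  exact: integrable_fin_num.
by rewrite -!EFinM -EFinD mulNr addNr.
Qed.
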